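(* Let $N$ be a 3-normalized Hadamard matrix of order $n=4k$ (with $k\ge 1$ an integer). Then the $\pm1$ matrix $\Gamma(N)$ of order $n+1$ constructed from $N$ has determinant $$\det\Gamma(N)=(-1)^{k+1}(\det N)\left(2+\frac{\operatorname{ex}(N)}{n}\right)=\pm\, n^{n/2}\left(2+\frac{\operatorname{ex}(N)}{n}\right).$$
   Context: A Hadamard matrix of order $n$ is an $n\times n$ matrix with all entries in $\{+1,-1\}$ whose rows are mutually orthogonal. The excess $\operatorname{ex}(X)$ of a matrix or vector $X$ is the sum of its entries; the $i$th row sum of a matrix is the sum of the entries of its $i$th row. Write $\mathbf{1}_m=(1,\dots,1)\in\mathbf{R}^m$. A Hadamard matrix $N$ of order $n=4k$ is called 3-normalized if its first three rows are, in blocks of $k$ consecutive columns, $$\begin{pmatrix} +&-&-&+\\ +&-&+&-\\ +&+&-&-\end{pmatrix},$$ where $+$ and $-$ stand for the row vectors $+\mathbf{1}_k$ and $-\mathbf{1}_k$ respectively, and all row sums of $N$ are non-negative. Construction of $\Gamma(N)$: (1) Start with a 3-normalized Hadamard matrix $N$ of order $n=4k$. (2) Let $N'$ be obtained from $N$ by negating its first $k$ columns; the upper left $3\times k$ block of $N'$ consists entirely of $-1$s. (3) Let $N''$ be obtained from $N'$ by changing all the $-1$s in its upper left $3\times k$ block to $+1$s; that is, $N''_{ij}=N'_{ij}+2$ if $i\le 3$ and $j\le k$, and $N''_{ij}=N'_{ij}$ otherwise. (4) Let $\Gamma(N)=E(N'')$, where for an $n\times n$ matrix $A$, $E(A)$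 is the $(n+1)\times(n+1)$ matrix $$E(A)=\begin{pmatrix} 1 & \mathbf{1}_n\\ -\mathbf{1}_n^{T} & A\end{pmatrix},$$ i.e. $-1$ is prepended to each row of $A$ and then a first row consisting entirely of $+1$s is added. *)

(* Defs.v *)
From HB Require Import structures.
From mathcomp Require Import all_boot all_order all_algebra.

Set Implicit Arguments.
Unset Strict Implicit.
Unset Printing Implicit Defensive.

Import Order.TTheory GRing.Theory Num.Theory.
Local Open Scope ring_scope.

Definition pm1_mx (R : realFieldType) (m n : nat) (A : 'M[R]_(m, n)) : Prop :=
  forall i j, A i j = 1 \/ A i j = -1.

Definition hadamard (R : realFieldType) (n : nat) (A : 'M[R]_n) : Prop :=
  pm1_mx A /\ forall i1 i2, i1 != i2 -> \sum_j A i1 j * A i2 j = 0.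

Definition excess (R : realFieldType) (m n : nat) (A : 'M[R]_(m, n)) : R :=
  \sum_i \sum_j A i j.

Definition row_sum (R : realFieldType) (m n : nat) (A : 'M[R]_(m, n))
    (i : 'I_m) : R :=
  \sum_j A i j.

Definition block_signs (R : realFieldType) : seq (seq R) :=
  [:: [:: 1; -1; -1;  1];
      [:: 1; -1;  1; -1];
      [:: 1;  1; -1; -1]].

(* Indices are 0-based: column j lies in block j %/ k. *)
Definition three_normalized (R : realFieldType) (k : nat)
    (N : 'M[R]_(4 * k)) : Prop :=
  (forall i j : 'I_(4 * k), (i < 3)%N ->
     N i j = nth 0 (nth [::] (block_signs R) i) (j %/ k)) /\
  (forall i, 0 <= row_sum N i).

Definition negate_first_cols (R : realFieldType) (k : nat)
    (N : 'M[R]_(4 * k)) : 'M[R]_(4 * k) :=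
  \matrix_(i, j) (if (j < k)%N then - N i j else N i j).

Definition switch_block (R : realFieldType) (k : nat)
    (N' : 'M[R]_(4 * k)) : 'M[R]_(4 * k) :=
  \matrix_(i, j) (if (i < 3)%N && (j < k)%N then N' i j + 2 else N' i j).

Definition border (R : realFieldType) (n : nat) (A : 'M[R]_n) : 'M[R]_(1 + n) :=
  block_mx (const_mx 1) (const_mx 1) (const_mx (-1)) A.

Definition Gamma (R : realFieldType) (k : nat) (N : 'M[R]_(4 * k)) :
    'M[R]_(1 + 4 * k) :=
  border (switch_block (negate_first_cols N)).

(* Main.v *)
Require Import Defs.
From HB Require Import structures.
From mathcomp Require Import all_boot all_order all_algebra.
From mathcomp Require Import ring zify.

Import Order.TTheory GRing.Theory Num.Theory.
Local Open Scope ring_scope.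

(** The bordered matrix has determinant [\det (N'' + J)], with [J] the all-ones
    matrix (clear the first row by column operations).  Let [e] be the all-ones
    row, [v] and [p] the indicator rows of the first [k] columns and of the
    first three rows, and [D] the diagonal matrix of [e - 2 v].  Then
    [N' = N D] and [N'' + J = N D + 2 p^T v + e^T e]: a rank-two perturbation of
    a matrix whose determinant is [(-1)^k \det N] and whose inverse
    [X = n^-1 D N^T] is explicit because [N N^T = n I].  Sylvester's identity
    ([det_add1_mulmxC]) thus leaves the 2 x 2 determinant
    [(1 + 2 v X p^T) (1 + e X e^T) - (v X e^T) (2 e X p^T)].

    What makes its entries computable is that the all-ones row and the first
    three rows of [N] add up to [4 v] ([three_normalized_sum]), that is
    [p N = 4 v - e].  Orthogonality of the rows then gives
    [4 v N^T = e N^T + n p], so that the sum of the entries of [N] in its first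
    [k] columns is [(ex N + 3 n) / 4].  Hence [v X p^T = -3/4],
    [e X p^T = -3/2], [v X e^T = - (ex N / n + 3) / 4] and
    [e X e^T = (ex N / n - 3) / 2], and the 2 x 2 determinant equals
    [- (2 + ex N / n)].  The second form of the value follows from
    [(\det N)^2 = n^n]. *)

(** * Determinant identities *)

(** Sylvester's identity: both sides are the determinant of the block matrix
    with unit diagonal blocks and off-diagonal blocks [- Q] and [P], which a
    unitriangular factor makes block triangular on either side. *)
Lemma det_add1_mulmxC (R : comPzRingType) (m n : nat)
    (P : 'M[R]_(n, m)) (Q : 'M[R]_(m, n)) :
  \det (1%:M + P *m Q) = \det (1%:M + Q *m P).
Proof.
pose B := block_mx 1%:M (- Q) P 1%:M.
pose T := block_mx 1%:M Q 0 (1%:M : 'M_n).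
have detT : \det T = 1 by rewrite det_ublock !det1 mulr1.
have BT : B *m T = block_mx 1%:M 0 P (1%:M + P *m Q).
  by rewrite mulmx_block !mulmx1 !mul1mx !mulmx0 !addr0 subrr
    (addrC (P *m Q)).
have TB : T *m B = block_mx (1%:M + Q *m P) 0 P 1%:M.
  by rewrite mulmx_block !mulmx1 !mul1mx !mul0mx !add0r addNr.
have detB : \det B = \det (1%:M + P *m Q).
  by rewrite -[LHS]mulr1 -[X in _ * X]detT -det_mulmx BT det_lblock det1 mul1r.
rewrite -detB -[LHS]mul1r -[X in X * _]detT -det_mulmx TB.
by rewrite det_lblock det1 mulr1.
Qed.

(** Factor out [A] on the left; Sylvester's identity then shrinks the remaining
    determinant from order [n] to the number [m] of columns of [U]. *)
Lemma det_add_mulmx (R : comPzRingType) (m n : nat) (A X : 'M[R]_n)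
    (U : 'M[R]_(n, m)) (V : 'M[R]_(m, n)) :
  A *m X = 1%:M -> \det (A + U *m V) = \det A * \det (1%:M + V *m X *m U).
Proof.
move=> AX; rewrite -mulmxA -det_add1_mulmxC -det_mulmx mulmxDr mulmx1.
by rewrite !mulmxA AX mul1mx.
Qed.

Lemma det_block_mx11 (R : comPzRingType) (A B C D : 'M[R]_1) :
  \det (block_mx A B C D) = A 0 0 * D 0 0 - B 0 0 * C 0 0.
Proof.
rewrite (expand_det_row _ (lshift 1 ord0)) big_split_ord /= !big_ord1.
have minorE i j : (row' i (col' j (block_mx A B C D))) 0 0 =
    block_mx A B C D (lift i (0 : 'I_1)) (lift j (0 : 'I_1)) by rewrite 2!mxE.
have -> : (ord0 : 'I_1) = 0 by apply: val_inj.
have lift0 : lift (lshift 1 (0 : 'I_1)) (0 : 'I_1) = rshift 1 (0 : 'I_1).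
  exact: val_inj.
have lift1 : lift (rshift 1 (0 : 'I_1)) (0 : 'I_1) = lshift 1 (0 : 'I_1).
  exact: val_inj.
rewrite /cofactor !det_mx11 !minorE !lift0 !lift1.
rewrite block_mxEul block_mxEur block_mxEdr block_mxEdl /=.
by rewrite expr0 expr1 mul1r mulN1r mulrN.
Qed.

(** Subtracting the first column from the others clears the first row; in the
    lower right block this adds [1] to every entry, as the border there is
    [-1]. *)
Lemma det_border (R : realFieldType) (n : nat) (A : 'M[R]_n) :
  \det (border A) = \det (A + const_mx 1).
Proof.
pose T := block_mx 1%:M (const_mx (-1)) 0 1%:M : 'M[R]_(1 + n).
have detT : \det T = 1 by rewrite det_ublock !det1 mulr1.
rewrite -[LHS]mulr1 -[X in _ * X]detT -det_mulmx mulmx_block.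
rewrite !mulmx1 !mulmx0 !addr0.
have -> : (const_mx 1 : 'M_1) *m const_mx (-1) + const_mx 1 = 0
    :> 'M[R]_(1, n).
  by apply/matrixP=> i j; rewrite !mxE big_ord1 !mxE mul1r addNr.
rewrite det_lblock det_mx11 mxE mul1r addrC; congr (\det (_ + _)).
by apply/matrixP=> i j; rewrite !mxE big_ord1 !mxE mulrNN mulr1.
Qed.

(** * Indicator rows of initial segments *)

Definition head_row (R : pzSemiRingType) (n m : nat) : 'rV[R]_n :=
  \row_j (j < m)%:R.

Lemma head_row_full (R : pzSemiRingType) (n : nat) :
  head_row R n n = const_mx 1.
Proof. by apply/rowP=> j; rewrite !mxE ltn_ord. Qed.

Lemma head_row_dot (R : comPzSemiRingType) (n m1 m2 : nat) :
  (m1 <= m2)%N -> (m1 <= n)%N ->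
  head_row R n m1 *m (head_row R n m2)^T = m1%:R%:M.
Proof.
move=> le12 le1n; apply/matrixP=> i j; rewrite !ord1 !mxE eqxx mulr1n.
under eq_bigr => l _ do
  rewrite !mxE -natrM mulnb (andb_idr (fun h => leq_trans h le12)) mulrb.
by rewrite -big_mkcond -(big_ord_widen n (fun=> 1)) // sumr_const card_ord.
Qed.

Lemma head_rowM (R : pzSemiRingType) (n m q : nat) (A : 'M[R]_(n, q))
    (F : nat -> R) (j : 'I_q) :
  (m <= n)%N -> (forall i : 'I_n, (i < m)%N -> A i j = F i) ->
  (head_row R n m *m A) 0 j = \sum_(i < m) F i.
Proof.
move=> le_mn AF; rewrite (big_ord_widen n F) // big_mkcond mxE.
apply: eq_bigr => i _; rewrite !mxE.
by case: ifP => [/AF->|_]; rewrite ?mul1r ?mul0r.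
Qed.

Definition head_sign (R : pzRingType) (n m : nat) : 'M[R]_n :=
  diag_mx (const_mx 1 - 2 *: head_row R n m).

Lemma head_sign_entry (R : pzRingType) (n m : nat) (j : 'I_n) :
  (const_mx 1 - 2 *: head_row R n m) 0 j = (-1) ^+ (j < m)%N.
Proof.
rewrite !mxE; case: (j < m)%N; last by rewrite mulr0 subr0.
by rewrite mulr1 opprD addrA subrr sub0r.
Qed.

Lemma det_head_sign (R : comPzRingType) (n m : nat) :
  (m <= n)%N -> \det (head_sign R n m) = (-1) ^+ m.
Proof.
move=> le_mn; rewrite det_diag; under eq_bigr do rewrite head_sign_entry.
rewrite -[in RHS](card_ord m) -prodr_const.
rewrite (big_ord_widen n (fun=> -1)) // [RHS]big_mkcond.
by apply: eq_bigr => j _; case: (j < m)%N.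
Qed.

Lemma head_sign_invol (R : comPzRingType) (n m : nat) :
  head_sign R n m *m head_sign R n m = 1%:M.
Proof.
rewrite mulmx_diag; apply/matrixP=> i j; rewrite 2!mxE !head_sign_entry.
by rewrite -signr_addb addbb mxE.
Qed.

Lemma head_sign_tr (R : comPzRingType) (n m : nat) :
  (head_sign R n m)^T = head_sign R n m.
Proof. exact: tr_diag_mx. Qed.

Lemma head_row_sign (R : comPzRingType) (n m : nat) :
  head_row R n m *m head_sign R n m = - head_row R n m.
Proof.
rewrite mul_mx_diag; apply/rowP=> j; rewrite mxE head_sign_entry !mxE.
by case: (j < m)%N; rewrite ?mul0r ?oppr0 // mul1r.
Qed.

Lemma const_row_sign (R : comPzRingType) (n m : nat) :
  const_mx 1 *m head_sign R n m = const_mx 1 - 2 *: head_row R n m.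
Proof.
by rewrite mul_mx_diag; apply/rowP=> j; rewrite mxE [X in X * _]mxE mul1r.
Qed.

(** * Hadamard matrices *)

Lemma hadamard_mul_tr (R : realFieldType) (n : nat) (A : 'M[R]_n) :
  hadamard A -> A *m A^T = n%:R%:M.
Proof.
case=> pmA orthA; apply/matrixP=> i j; rewrite !mxE.
under eq_bigr => l _ do rewrite mxE.
have [<-|ne_ij] := eqVneq i j; last exact: orthA.
rewrite (eq_bigr (fun=> 1)) ?sumr_const ?card_ord // => l _.
by case: (pmA i l) => ->; rewrite ?mulrNN mulr1.
Qed.

Lemma hadamard_det (R : realFieldType) (n : nat) (A : 'M[R]_n) :
  ~~ odd n -> hadamard A ->
  \det A = n%:R ^+ (n %/ 2) \/ \det A = - n%:R ^+ (n %/ 2).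
Proof.
move=> even_n /hadamard_mul_tr/(congr1 (fun B => \det B)).
rewrite det_mulmx det_tr det_scalar -expr2 => detA2.
have /orP[] : (\det A == n%:R ^+ (n %/ 2)) || (\det A == - n%:R ^+ (n %/ 2)).
- by rewrite -eqf_sqr detA2 -exprM divnK // dvdn2.
- by move/eqP; left.
- by move/eqP; right.
Qed.

Lemma excess_mulmx (R : realFieldType) (m n : nat) (A : 'M[R]_(m, n)) :
  const_mx 1 *m A^T *m const_mx 1 = (excess A)%:M :> 'M_1.
Proof.
apply/matrixP=> i j; rewrite !ord1 mxE [RHS]mxE eqxx mulr1n.
apply: eq_bigr => l _; rewrite [X in _ * X]mxE mulr1 mxE.
by apply: eq_bigr => h _; rewrite !mxE mul1r.
Qed.

(** Down each column the three signs are all [+] in the first block, and one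
    [+] with two [-] in each other block: adding [1] to their sum leaves four
    times the indicator of the first block. *)
Lemma three_normalized_sum (R : realFieldType) (k : nat) (N : 'M[R]_(4 * k)) :
  (0 < k)%N -> three_normalized N ->
  head_row R (4 * k) 3 *m N = 4 *: head_row R (4 * k) k - const_mx 1.
Proof.
move=> k_gt0 [rowsN _]; apply/rowP=> j.
rewrite (@head_rowM _ _ _ _ _
  (fun i => nth 0 (nth [::] (block_signs R) i) (j %/ k))); first last.
- by move=> i; apply: rowsN.
- by lia.
have lt_j4 : (j %/ k < 4)%N by rewrite ltn_divLR // ltn_ord.
rewrite !big_ord_recl big_ord0 /= !mxE.
have -> : (j < k)%N = (j %/ k == 0)%N.
  by rewrite -[RHS]leqn0 -[RHS]ltnS ltn_divLR // mul1n.
by case: (j %/ k)%N lt_j4 => [|[|[|[|//]]]] _ /=; ring.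
Qed.

(** * The matrix Gamma *)

Lemma Gamma_pm1 (R : realFieldType) (k : nat) (N : 'M[R]_(4 * k)) :
  pm1_mx N -> three_normalized N -> pm1_mx (Gamma N).
Proof.
move=> pmN [rowsN _] i j; rewrite /Gamma /border.
case: (split_ordP i) => i' ->; case: (split_ordP j) => j' ->.
- by rewrite block_mxEul mxE; left.
- by rewrite block_mxEur mxE; left.
- by rewrite block_mxEdl mxE; right.
rewrite block_mxEdr !mxE; case: ifP => [/andP[lt_i3 lt_jk]|_].
  rewrite lt_jk rowsN // divn_small //.
  by case: (nat_of_ord i') lt_i3 => [|[|[|]]] //= _; left; ring.
by case: (pmN i' j') => ->; case: ifP; rewrite ?opprK; auto.
Qed.

Lemma Gamma_core (R : realFieldType) (k : nat) (N : 'M[R]_(4 * k)) :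
  switch_block (negate_first_cols N) + const_mx 1 =
    N *m head_sign R (4 * k) k
    + row_mx (2 *: (head_row R (4 * k) 3)^T) (const_mx 1 : 'cV_(4 * k))
      *m col_mx (head_row R (4 * k) k) (const_mx 1 : 'rV_(4 * k)).
Proof.
rewrite mul_row_col mul_mx_diag addrA; apply/matrixP=> i j.
rewrite [LHS]mxE [RHS]mxE [X in X + _]mxE [X in _ = X + _]mxE.
rewrite [X in _ = X + _ + _]mxE head_sign_entry !mxE !big_ord1 !mxE.
by case: (i < 3)%N; case: (j < k)%N => /=; ring.
Qed.

Lemma det_Gamma (R : realFieldType) (k : nat) (N : 'M[R]_(4 * k)) :
  (0 < k)%N -> hadamard N -> three_normalized N ->
  \det (Gamma N) = (-1) ^+ k.+1 * \det N * (2 + excess N / (4 * k)%:R).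
Proof.
move=> k_gt0 hadN normN; rewrite /Gamma det_border Gamma_core.
set n := (4 * k)%N; set D := head_sign R n k.
set p := head_row R n 3; set v := head_row R n k.
pose e : 'rV[R]_n := const_mx 1.
rewrite -[X in col_mx _ X]/e -[X in row_mx _ X]trmx_const -/e.
have k_neq0 : k%:R != 0 :> R by rewrite pnatr_eq0 -lt0n.
have nE : n%:R = 4 * k%:R :> R by rewrite natrM.
have n_neq0 : n%:R != 0 :> R by rewrite nE mulf_neq0 // pnatr_eq0.
have NNt : N *m N^T = n%:R%:M by apply: hadamard_mul_tr.
have pN : p *m N = 4 *: v - e by apply: three_normalized_sum.
have vD : v *m D = - v by apply: head_row_sign.
have eD : e *m D = e - 2 *: v by apply: const_row_sign.
pose X := n%:R^-1 *: (D *m N^T).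
have NDX : N *m D *m X = 1%:M.
  rewrite -scalemxAr mulmxA -(mulmxA N) head_sign_invol mulmx1 NNt.
  by rewrite scale_scalar_mx mulVf.
(* [N^T p^T] is the transpose of [p N], so [n X p^T] is [((4 v - e) D)^T]. *)
have Xp : X *m p^T = - (n%:R^-1 *: (e^T + 2 *: v^T)).
  rewrite -scalemxAl -mulmxA -trmx_mul pN -scalerN -[D]head_sign_tr -trmx_mul.
  rewrite mulmxBl -scalemxAl vD eD; congr (_ *: _).
  by apply/colP=> j; rewrite !mxE; ring.
have ve : v *m e^T = k%:R%:M.
  by rewrite /e -head_row_full head_row_dot // leq_pmull.
have ev : e *m v^T = k%:R%:M.
  by rewrite -[LHS]trmxK trmx_mul trmxK ve tr_scalar_mx.
have vv : v *m v^T = k%:R%:M by rewrite head_row_dot // leq_pmull.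
have ee : e *m e^T = n%:R%:M by rewrite /e -head_row_full head_row_dot.
have pe : p *m e^T = 3%:M by rewrite /e -head_row_full head_row_dot //; lia.
have eNe : e *m N^T *m e^T = (excess N)%:M by rewrite trmx_const excess_mulmx.
(* The sum of the entries in the first [k] columns, from [4 v = e + p N]. *)
have vNe : v *m N^T *m e^T = ((excess N + 3 * n%:R) / 4)%:M.
  have -> : v = 4^-1 *: (e + p *m N).
    by rewrite pN addrC subrK scalerA mulVf ?scale1r // pnatr_eq0.
  rewrite -!scalemxAl !mulmxDl -(mulmxA p) NNt eNe mul_mx_scalar -scalemxAl pe.
  apply/matrixP=> i j; rewrite !ord1 !mxE eqxx !mulr1n.
  by rewrite mulrC (mulrC n%:R).
have vXp : (v *m X *m p^T) 0 0 = - (3 / 4).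
  rewrite -mulmxA Xp mulmxN -scalemxAr mulmxDr -scalemxAr ve vv.
  by rewrite !mxE eqxx !mulr1n nE; field.
have eXp : (e *m X *m p^T) 0 0 = - (3 / 2).
  rewrite -mulmxA Xp mulmxN -scalemxAr mulmxDr -scalemxAr ev ee.
  by rewrite !mxE eqxx !mulr1n nE; field.
have vXe : (v *m X *m e^T) 0 0 = - ((excess N / n%:R + 3) / 4).
  rewrite -scalemxAr mulmxA vD -!scalemxAl !mulNmx vNe.
  by rewrite !mxE eqxx !mulr1n; field.
have eXe : (e *m X *m e^T) 0 0 = (excess N / n%:R - 3) / 2.
  rewrite -scalemxAr mulmxA eD -!scalemxAl !mulmxBl -!scalemxAl eNe vNe.
  by rewrite !mxE eqxx !mulr1n; field.
rewrite (det_add_mulmx _ _ _ _ _ _ _ NDX) det_mulmx det_head_sign ?leq_pmull //.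
rewrite mul_col_mx mul_col_row (scalar_mx_block 1 1) add_block_mx !add0r.
rewrite det_block_mx11 -!(scalemxAr 2).
have addE (A B : 'M[R]_1) : (A + B) 0 0 = A 0 0 + B 0 0 by rewrite mxE.
have scaleE a (A : 'M[R]_1) : (a *: A) 0 0 = a * A 0 0 by rewrite mxE.
have oneE : (1%:M : 'M[R]_1) 0 0 = 1 by rewrite mxE.
rewrite !addE !scaleE oneE vXp eXe vXe eXp exprS.
by field.
Qed.

Theorem theorem3p1 (R : realFieldType) (k : nat) (k_gt0 : (0 < k)%N)
    (N : 'M[R]_(4 * k)) (N_hadamard : hadamard N)
    (N_normalized : three_normalized N) :
  let n := (4 * k)%N in
  [/\ pm1_mx (Gamma N),
      \det (Gamma N) = (-1) ^+ k.+1 * \det N * (2 + excess N / n%:R)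
    & \det (Gamma N) = n%:R ^+ (n %/ 2) * (2 + excess N / n%:R) \/
      \det (Gamma N) = - (n%:R ^+ (n %/ 2) * (2 + excess N / n%:R))].
Proof.
move=> n; have detG := det_Gamma _ _ _ k_gt0 N_hadamard N_normalized.
split=> //; first by case: N_hadamard => pmN _; apply: Gamma_pm1.
have even_n : ~~ odd n by rewrite oddM.
rewrite detG -signr_odd -mulNr.
by case: (hadamard_det _ _ _ even_n N_hadamard) => ->; case: (odd _);
   rewrite ?expr0 ?expr1 ?mul1r ?mulN1r ?opprK; auto.
Qed.
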